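(* Let $W$ be a finite simply laced Coxeter group, let $w$ be a freely braided element of $W$, and let $\mathbf{i}=i_1\cdots i_n$ be a contracted reduced expression for $w$ with braid sequence $\mathbf{b}_1,\dots,\mathbf{b}_{N(w)}$. Then the expression obtained from $\mathbf{i}$ by deleting any letter (i.e. the letter in any one position), except a middle letter from one of the braids $\mathbf{b}_l$, is reduced.
   Context: $W$ has distinguished generators $S=\{s_i : i\in I\}$ and Coxeter matrix $(m_{ij})_{i,j\in I}$; simply laced means $m_{ij}\in\{2,3\}$ for all $i\neq j$. Words: $I^*$ is the free monoid on $I$, and $\phi: I^*\to W$ is the monoid morphism with $\phi(i)=s_i$. A word represents its image under $\phi$. A word of minimal length among those representing $w$ is a reduced expression for $w$ (such a word is called reduced); its length is $\ell(w)$. Roots: $V$ is the real vector space with basis $\{\alpha_i : i\in I\}$ with the symmetric bilinear form (Coxeter form) $B(\alpha_i,\alpha_j) = -\cos(\pi/m_{ij})$, and $W$ acts on $V$ by $s_i\alpha_j = \alpha_j - 2B(\alpha_j,\alpha_i)\alpha_i$. The root system is $\Phi=\{w\alpha_i : w\in W, i\in I\}$; $\Phi^+$ is the set of roots that are linear combinations of the $\alpha_i$ with nonnegative coefficients, and $\Phi^-=-\Phi^+$. The inversion set of $w$ is $\Phi(w)=\Phi^+\cap w^{-1}(\Phi^-)$. Root sequences: given a reduced expression $i_1i_2\cdots i_n$ for $w$, its root sequence is $(r_1,\dots,r_n)$, where $r_1=\alpha_{i_n}$ and $r_l=s_{i_n}\cdots s_{i_{n-l+2}}(\alpha_{i_{n-l+1}})$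 for $2\le l\le n$; its entries are exactly the elements of $\Phi(w)$. It is called a root sequence for $w$. Inversion triples: an inversion triple of $w$ is a subset of $\Phi(w)$ of the form $\{\alpha,\beta,\alpha+\beta\}$. An inversion triple $T$ of $w$ is contractible if there is a root sequence for $w$ in which the elements of $T$ appear consecutively (in some order). $N(w)$ is the number of contractible inversion triples of $w$. The element $w$ is freely braided if its contractible inversion triples are pairwise disjoint. Contracted expressions: if a word $\mathbf{i}\in I^*$ can be written as $\mathbf{u}_0\mathbf{b}_1\mathbf{u}_1\mathbf{b}_2\mathbf{u}_2\cdots\mathbf{b}_p\mathbf{u}_p$ with words $\mathbf{u}_l \in I^*$ (possibly empty), where each $\mathbf{b}_l$ is of the form $iji$ for some $i,j\in I$ with $m_{ij}=3$, then $\mathbf{b}_1,\dots,\mathbf{b}_p$ is called a braid sequence for $\mathbf{i}$ (each $\mathbf{b}_l$ being understood as the corresponding factor occurring in $\mathbf{i}$; its middle letter is the occurrence of $j$). If $\mathbf{i}$ is reduced and $w=\phi(\mathbf{i})$ is freely braided, then $\mathbf{i}$ is called contracted if there exists a braid sequence for $\mathbf{i}$ with $p=N(w)$ terms. *)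

(* Defs.v *)
From HB Require Import structures.
From mathcomp Require Import all_boot all_order all_algebra all_fingroup.
From mathcomp Require Import finmap.
From mathcomp Require Import all_classical all_reals all_analysis.
From mathcomp Require Import ring lra.

Set Implicit Arguments.
Unset Strict Implicit.
Unset Printing Implicit Defensive.

Import Order.TTheory GRing.Theory Num.Theory.

Local Open Scope classical_set_scope.
Local Open Scope ring_scope.

(* As usual, the entry [0] encodes [m_ij = oo]: the corresponding relation
   [(s i * s j) ^+ 0 = 1] is vacuous. *)
Definition coxeter_matrix (I : finType) (m : I -> I -> nat) : Prop :=
  [/\ forall i, m i i = 1%N,
      forall i j, m i j = m j i
    & forall i j, i != j -> m i j != 1%N].

Definition simply_laced (I : finType) (m : I -> I -> nat) : Prop :=
  forall i j, i != j -> m i j = 2%N \/ m i j = 3%N.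

(* The monoid morphism [phi] from words to [W], with [phi(i) = s_i]. *)
Definition word_val (I : Type) (W : groupType) (s : I -> W) (u : seq I) : W :=
  (\prod_(i <- u) s i)%g.

(* [W] is the group presented by the generators [s i] and the relations
   [(s i * s j) ^+ m i j = 1]. *)
Record coxeter_system (I : finType) (m : I -> I -> nat)
    (W : groupType) (s : I -> W) : Prop := CoxeterSystem {
  coxeter_rel : forall i j, ((s i * s j) ^+ m i j = 1)%g;
  coxeter_gen : forall w : W, exists u : seq I, word_val s u = w;
  coxeter_univ : forall (G : groupType) (f : I -> G),
    (forall i j, ((f i * f j) ^+ m i j = 1)%g) ->
    exists g : {multiplicative W -> G}, forall i, g (s i) = f i
}.

Section Coxeter.
Context (R : realType) (I : finType) (m : I -> I -> nat).
Context (W : groupType) (s : I -> W).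

Definition reduced (u : seq I) : Prop :=
  forall v : seq I, word_val s v = word_val s u -> (size u <= size v)%N.

Definition reduced_expression (w : W) (u : seq I) : Prop :=
  reduced u /\ word_val s u = w.

Definition root_space := {ffun I -> R^o}.

Definition simple_root (i : I) : root_space := [ffun j => (j == i)%:R].

Definition coxeter_form (x y : root_space) : R :=
  \sum_i \sum_j (x i : R) * (y j : R) * - cos (pi / (m i j)%:R).

Definition reflection (i : I) (v : root_space) : root_space :=
  v - (2 * coxeter_form v (simple_root i)) *: simple_root i.

Definition word_act (u : seq I) (v : root_space) : root_space :=
  foldr reflection v u.

(* The action of [W] on [V], computed from an arbitrary expression; see
   [act_word], [act_gen], [act1] and [actM] below for its well-definedness. *)
Definition act (w : W) (v : root_space) : root_space :=
  word_act (xget [::] [set u | word_val s u = w]) v.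

Definition roots : set root_space :=
  [set v | exists (w : W) (i : I), v = act w (simple_root i)].

Definition positive_roots : set root_space :=
  [set v | roots v /\ forall i, 0 <= (v i : R)].

Definition negative_roots : set root_space :=
  [set v | positive_roots (- v)].

Definition inversion_set (w : W) : set root_space :=
  positive_roots `&` act w @^-1` negative_roots.

(* For [u = i_1 ... i_n], the last entry is
   [r_n = s_{i_n} ... s_{i_2} (alpha_{i_1})], and [r_1, ..., r_{n-1}] is the
   root sequence of [i_2 ... i_n]. *)
Fixpoint root_seq (u : seq I) : seq root_space :=
  if u is i :: u' then
    rcons (root_seq u') (word_act (rev u') (simple_root i))
  else [::].

Definition root_sequence_for (w : W) (rs : seq root_space) : Prop :=
  exists2 u : seq I, reduced_expression w u & rs = root_seq u.

Definition inversion_triple (w : W) (T : set root_space) : Prop :=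
  T `<=` inversion_set w /\
  exists a b : root_space, T = [set a; b; a + b].

Definition contractible (w : W) (T : set root_space) : Prop :=
  inversion_triple w T /\
  exists2 rs : seq root_space, root_sequence_for w rs
    & exists x y z : root_space,
        infix [:: x; y; z] rs /\ T = [set x; y; z].

Definition contractible_triples (w : W) : set (set root_space) :=
  [set T | contractible w T].

(* This set is finite, being contained in the powerset of the finite set
   [inversion_set w]; [fset_set] is used with its intended meaning. *)
Definition num_contractible (w : W) : nat :=
  #|` fset_set (contractible_triples w)|.

Definition freely_braided (w : W) : Prop :=
  forall T1 T2 : set root_space, contractible w T1 -> contractible w T2 ->
    T1 <> T2 -> T1 `&` T2 = set0.

(* The word [u_0 b_1 u_1 ... b_p u_p], where [bus] lists the pairs
   [(b_l, u_l)] for [l = 1, ..., p]. *)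
Definition braid_word (u0 : seq I) (bus : seq (seq I * seq I)) : seq I :=
  u0 ++ flatten [seq bu.1 ++ bu.2 | bu <- bus].

Definition braid_sequence (u : seq I) (u0 : seq I)
    (bus : seq (seq I * seq I)) : Prop :=
  u = braid_word u0 bus /\
  forall bu, bu \in bus ->
    exists i j : I, m i j = 3%N /\ bu.1 = [:: i; j; i].

(* Positions (counted from 0) in [braid_word u0 bus] of the middle letters of
   the [b_l]: the factor [b_(l+1)] starts right after [u_0 b_1 ... b_l u_l]. *)
Definition middle_positions (u0 : seq I) (bus : seq (seq I * seq I))
    : seq nat :=
  [seq (size (braid_word u0 (take l bus))).+1 | l <- iota 0 (size bus)].

Definition contracted (u : seq I) : Prop :=
  [/\ reduced u, freely_braided (word_val s u)
    & exists u0 bus, braid_sequence u u0 bus /\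
        size bus = num_contractible (word_val s u)].

Definition delete_letter (k : nat) (u : seq I) : seq I :=
  take k u ++ drop k.+1 u.

End Coxeter.

Section Bijections.
Context (T : Type).

Record bij_of := BijOf {
  bij_fun : T -> T;
  bij_inv : T -> T;
  bij_funK : cancel bij_fun bij_inv;
  bij_invK : cancel bij_inv bij_fun }.

HB.instance Definition _ := gen_eqMixin bij_of.
HB.instance Definition _ := gen_choiceMixin bij_of.

Lemma bijP (f g : bij_of) : bij_fun f =1 bij_fun g -> f = g.
Proof.
case: f g => [f f' fK f'K] [g g' gK g'K] /= /funext fg.
have fg' : f' = g' by apply/funext => x; rewrite -[x in LHS]g'K -fg fK.
by subst g g'; rewrite (Prop_irrelevance fK gK) (Prop_irrelevance f'K g'K).
Qed.

Definition bij_one :=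
  @BijOf id id (fun x : T => erefl x) (fun x : T => erefl x).
Definition bij_V (f : bij_of) := BijOf (@bij_invK f) (@bij_funK f).
Definition bij_mul (f g : bij_of) :=
  BijOf (can_comp (@bij_funK f) (@bij_funK g))
        (can_comp (@bij_invK g) (@bij_invK f)).

Let mulA : associative bij_mul. Proof. by move=> f g h; apply: bijP. Qed.
Let mul1 : left_id bij_one bij_mul. Proof. by move=> f; apply: bijP. Qed.
Let mulr1 : right_id bij_one bij_mul. Proof. by move=> f; apply: bijP. Qed.
Let mulV : left_inverse bij_one bij_V bij_mul.
Proof. by move=> f; apply: bijP => x /=; rewrite bij_funK. Qed.
Let mulrV : right_inverse bij_one bij_V bij_mul.
Proof. by move=> f; apply: bijP => x /=; rewrite bij_invK. Qed.

HB.instance Definition _ := isGroup.Build bij_of mulA mul1 mulr1 mulV mulrV.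

End Bijections.

Lemma cos_pi3 (R : realType) : cos (pi / 3) = 1 / 2 :> R.
Proof.
set x : R := pi / 3; set c := cos x.
have c0 : 0 < c.
  by apply: cos_gt0_pihalf; rewrite /x; have := pi_gt0 R; lra.
have : cos (x + x + x) = -1 by rewrite -cospi; congr cos; rewrite /x; field.
rewrite !cosD !sinD -/c => h.
have sc := cos2Dsin2 x; rewrite -/c in sc.
have : (c + 1) * (2 * c - 1) ^+ 2 = 0.
  have -> : (c + 1) * (2 * c - 1) ^+ 2 = 4 * c ^+ 3 - 3 * c + 1 by ring.
  move: h sc; set d := sin x => h sc.
  have d2 : d ^+ 2 = 1 - c ^+ 2 by lra.
  suff : 4 * c ^+ 3 - 3 * c = -1 by lra.
  rewrite -h.
  transitivity (c ^+ 3 - 3 * c * (1 - c ^+ 2)); first by ring.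
  by rewrite -d2; ring.
move/eqP; rewrite mulf_eq0 expf_eq0 /= => /orP[] /eqP; lra.
Qed.

Section ActionTheory.
Context (R : realType) (I : finType) (m : I -> I -> nat).
Local Notation V := (root_space R I).
Local Notation alpha := (@simple_root R I).
Local Notation B := (@coxeter_form R I m).
Local Notation refl := (@reflection R I m).

Lemma coxeter_form_simple (i j : I) :
  B (alpha i) (alpha j) = - cos (pi / (m i j)%:R).
Proof.
rewrite /coxeter_form (bigD1 i) //= [X in _ + X]big1 ?addr0; last first.
  move=> k ki; rewrite big1 // => l _.
  by rewrite ffunE (negbTE ki) !mul0r.
rewrite (bigD1 j) //= [X in _ + X]big1 ?addr0; last first.
  by move=> l lj; rewrite [alpha j l]ffunE (negbTE lj) mulr0 mul0r.
by rewrite !ffunE !eqxx !mul1r.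
Qed.

Lemma coxeter_formDl (x y z : V) : B (x + y) z = B x z + B y z.
Proof.
rewrite /coxeter_form -big_split; apply: eq_bigr => i _ /=.
rewrite -big_split; apply: eq_bigr => j _ /=; rewrite ffunE.
by rewrite !mulrDl.
Qed.

Lemma coxeter_formZl (a : R) (x z : V) : B (a *: x) z = a * B x z.
Proof.
rewrite /coxeter_form mulr_sumr; apply: eq_bigr => i _ /=.
rewrite mulr_sumr; apply: eq_bigr => j _ /=; rewrite ffunE.
by rewrite !mulrA.
Qed.

Lemma reflection_simple (i j : I) :
  refl i (alpha j) = alpha j - (2 * B (alpha j) (alpha i)) *: alpha i.
Proof. by []. Qed.

Lemma reflection_comb (v : V) (i j : I) (x y : R) :
  refl i (v + x *: alpha i + y *: alpha j) =
  v + (x - 2 * (B v (alpha i) + x * B (alpha i) (alpha i)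
                + y * B (alpha j) (alpha i))) *: alpha i + y *: alpha j.
Proof.
rewrite /reflection !coxeter_formDl !coxeter_formZl.
by rewrite scalerBl -!addrA; congr (_ + (_ + _)); rewrite addrC.
Qed.

Hypothesis (mC : coxeter_matrix m).

Lemma coxeter_form1 (i : I) : B (alpha i) (alpha i) = 1.
Proof. by case: mC => m1 _ _; rewrite coxeter_form_simple m1 divr1 cospi opprK. Qed.

Lemma reflectionK (i : I) : involutive (refl i).
Proof.
move=> v; have e : v = v + 0 *: alpha i + 0 *: alpha i by rewrite !scale0r !addr0.
rewrite {1}e !reflection_comb coxeter_form1 scale0r addr0.
set x := (X in v + X *: _); suff -> : x = 0 by rewrite scale0r addr0.
by rewrite /x; ring.
Qed.

Definition refl_bij (i : I) : bij_of V :=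
  BijOf (@reflectionK i) (@reflectionK i).

Lemma refl_bij_rel (i j : I) : simply_laced m ->
  ((refl_bij i * refl_bij j) ^+ m i j = 1)%g.
Proof.
move=> sl; have [m1 mS _] := mC.
have [<-|ij] := eqVneq i j.
  by rewrite m1; apply: bijP => v /=; rewrite reflectionK.
apply: bijP => v.
have e : v = v + 0 *: alpha i + 0 *: alpha j by rewrite !scale0r !addr0.
have reflj (x y : R) : refl j (v + x *: alpha i + y *: alpha j) =
  v + x *: alpha i + (y - 2 * (B v (alpha j) + y * B (alpha j) (alpha j)
                + x * B (alpha i) (alpha j))) *: alpha j.
  by rewrite addrAC reflection_comb addrAC.
have fin (x y : R) : x = 0 -> y = 0 -> v + x *: alpha i + y *: alpha j = v.
  by move=> -> ->; rewrite -e.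
have [mij|mij] := sl _ _ ij; have := coxeter_form_simple i j;
  have := coxeter_form_simple j i; rewrite mS mij.
- rewrite cos_pihalf oppr0 => bji bij.
  rewrite /= {1}e !(reflj, reflection_comb) !coxeter_form1 bij bji.
  by apply: fin; ring.
- rewrite cos_pi3 => bji bij.
  rewrite /= {1}e !(reflj, reflection_comb) !coxeter_form1 bij bji.
  by apply: fin; field.
Qed.

Context (W : groupType) (s : I -> W).
Hypotheses (slm : simply_laced m) (cs : coxeter_system m s).
Local Notation act := (@act R I m W s).

Lemma act_word (u : seq I) (v : V) :
  act (word_val s u) v = word_act m u v.
Proof.
have [g gs] := coxeter_univ cs (fun i j => refl_bij_rel i j slm).
have gu u' x : bij_fun (g (word_val s u')) x = word_act m u' x.
  rewrite /word_val; elim: u' x => [|i u' IH] x.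
    rewrite big_nil.
    have -> : g 1%g = 1%g by apply: (mulgI (g 1%g)); rewrite -gmulfM !mulg1.
    by [].
  by rewrite big_cons gmulfM gs /= IH.
rewrite /act -!gu; case: xgetP => [u' _ -> //|/(_ u)]; by case.
Qed.

Lemma act1 (v : V) : act 1%g v = v.
Proof. by have := act_word [::] v; rewrite /word_val big_nil. Qed.

Lemma act_gen (i : I) (v : V) : act (s i) v = refl i v.
Proof.
have -> : s i = word_val s [:: i] by rewrite /word_val big_seq1.
by rewrite act_word.
Qed.

Lemma actM (x y : W) (v : V) : act (x * y)%g v = act x (act y v).
Proof.
have [u <-] := coxeter_gen cs x; have [u' <-] := coxeter_gen cs y.
have -> : (word_val s u * word_val s u')%g = word_val s (u ++ u').
  by rewrite /word_val big_cat.
by rewrite !act_word /word_act foldr_cat.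
Qed.

End ActionTheory.

(* Main.v *)
Require Import Defs.
From mathcomp Require Import all_boot all_order all_algebra all_fingroup.
From mathcomp Require Import finmap.
From mathcomp Require Import all_classical all_reals all_analysis.
From mathcomp Require Import zify ring lra.

(** Let [r] be the inversion of [w] attached to the deleted letter. A word is
   reduced exactly when the roots attached to its letters are all positive, so
   if the shortened word is not reduced, some root changes sign in it: the
   letter [y] at which this shows lies left of the deleted letter, and the
   root of [y] has become the opposite of the root of a letter [z] on the
   right. The roots [c] of [y] and [d] of [z] in the original word then satisfy
   [c + d = r] ([deletion_triple]), hence [r] is the highest root of an
   inversion triple of [w].

   The core is [inversion_triple_contracts]: in a freely braided element of a
   finite group every inversion triple [{c, d, c + d}] is contractible. This is
   by induction on the length of [w]. If some right descent [z] of [w] has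
   [alpha z] outside the triple, [w * s z] is treated instead. Otherwise
   [d = alpha z], say; let [k] be a right descent of [w * s z].
   - If [k] is also a descent of [w], then either [alpha k] is outside the
     triple, or [w] ends with the braid of [z] and [k].
   - If not, then [alpha k + alpha z] is an inversion and [alpha k] is not;
     the form being positive definite, [alpha k] pairs with [c] to -1, 0 or 1,
     and -1 is easily excluded.
     -- In case of 0, the inversion triple of [c] and [alpha k + alpha z]
        belongs to [w * s z]; by induction some reduced expression has it
        consecutive with [c] first in the root sequence, so that the leftmost
        letter can be removed without losing the triple of [c] and [d].
     -- In case of 1, [c - alpha k] and [alpha k + alpha z] form a second
        inversion triple with the same highest root, contractible by
        induction. A root sequence in which [c - alpha k] precedes
        [alpha k + alpha z] exhibits a right descent of [w * s z] other than
        [k], to which the same analysis applies; if it again ends in this last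
        case, two distinct contractible triples share their highest root,
        contrary to free braidedness.

   Finally the [N(w)] disjoint braids of the contracted expression give [N(w)]
   distinct contractible triples ([triple_inj]), so all of them. As a triple of
   positive roots determines its highest root, [r] is attached to the middle
   letter of one of the braids, and distinct letters have distinct roots. *)

Set Implicit Arguments.
Unset Strict Implicit.
Unset Printing Implicit Defensive.

Import Order.TTheory GRing.Theory Num.Theory.

(** * Length and descents *)

Section Length.
Local Open Scope group_scope.
Context (I : finType) (m : I -> I -> nat) (W : groupType) (s : I -> W).
Hypotheses (hm : coxeter_matrix m) (hW : coxeter_system m s).
Local Notation phi := (word_val s).

Lemma gen_sq i : s i * s i = 1.
Proof. by have [m1 _ _] := hm; have := coxeter_rel hW i i; rewrite m1 expg1. Qed.

Lemma genK x i : x * s i * s i = x.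
Proof. by rewrite -mulgA gen_sq mulg1. Qed.

Lemma genKl x i : s i * (s i * x) = x.
Proof. by rewrite mulgA gen_sq mul1g. Qed.

Lemma gen_inv i : (s i)^-1 = s i.
Proof. by apply: (mulgI (s i)); rewrite mulgV gen_sq. Qed.

Lemma gen_commute i j : m i j = 2%N -> s i * s j = s j * s i.
Proof.
move=> m2; have := coxeter_rel hW i j; rewrite m2 expgS expg1 => h.
by apply: (mulgI (s i * s j)); rewrite h mulgA genK gen_sq.
Qed.

Lemma gen_braid i j : m i j = 3%N -> s i * s j * s i = s j * s i * s j.
Proof.
move=> m3; have := coxeter_rel hW i j; rewrite m3 2!expgS expg1 !mulgA => h.
apply: (mulIg (s j)); rewrite genK; apply: (mulIg (s i)); rewrite genK.
by apply: (mulIg (s j)); rewrite h gen_sq.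
Qed.

Lemma word_val_nil : phi [::] = 1. Proof. by rewrite /word_val big_nil. Qed.

Lemma word_val_cons i u : phi (i :: u) = s i * phi u.
Proof. by rewrite /word_val big_cons. Qed.

Lemma word_val_cat u v : phi (u ++ v) = phi u * phi v.
Proof. by rewrite /word_val big_cat. Qed.

Lemma word_val_rcons u i : phi (rcons u i) = phi u * s i.
Proof. by rewrite -cats1 word_val_cat word_val_cons word_val_nil mulg1. Qed.

Lemma word_val_rev u : phi (rev u) = (phi u)^-1.
Proof.
elim: u => [|i u IH]; first by rewrite word_val_nil invg1.
by rewrite rev_cons word_val_rcons word_val_cons invgM gen_inv IH.
Qed.

Lemma ex_word_size w : exists n, `[< exists2 u, phi u = w & size u = n >].
Proof.
by have [u uw] := coxeter_gen hW w; exists (size u); apply/asboolP; exists u.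
Qed.

Definition len (w : W) : nat := ex_minn (ex_word_size w).

Lemma lenP w : exists2 u, phi u = w & size u = len w.
Proof. by rewrite /len; case: ex_minnP => n /asboolP. Qed.

Lemma len_word u : (len (phi u) <= size u)%N.
Proof.
by rewrite /len; case: ex_minnP => n _; apply; apply/asboolP; exists u.
Qed.

Lemma reducedE u : reduced s u <-> size u = len (phi u).
Proof.
split=> [ru|ru v vu]; last by rewrite ru -vu len_word.
have [v vu sv] := lenP (phi u).
by apply/eqP; rewrite eqn_leq len_word andbT -sv ru.
Qed.

Lemma len1 : len 1 = 0%N.
Proof. by apply/eqP; rewrite -leqn0 -word_val_nil len_word. Qed.

Lemma len_gen_le i : (len (s i) <= 1)%N.
Proof. by have := len_word [:: i]; rewrite word_val_cons word_val_nil mulg1. Qed.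

Lemma len_mul x y : (len (x * y) <= len x + len y)%N.
Proof.
have [[u <- <-] [v <- <-]] := (lenP x, lenP y).
by rewrite -size_cat -word_val_cat len_word.
Qed.

Lemma lenV x : len x^-1 = len x.
Proof.
suff le y : (len y^-1 <= len y)%N.
  by apply/eqP; rewrite eqn_leq le /= -{1}(invgK x) le.
by have [u <- <-] := lenP y; rewrite -word_val_rev -size_rev len_word.
Qed.

(** By the universal property there is a sign character, taken here with values
   in the group of bijections of [bool]. It makes the parity of the length
   additive, so that multiplication by a generator cannot preserve the
   length. *)
Lemma odd_len_word u : odd (len (phi u)) = odd (size u).
Proof.
pose neg := BijOf negbK negbK : bij_of bool.
have [i j|g gs] := @coxeter_univ _ _ _ _ hW _ (fun _ : I => neg).
  suff -> : neg * neg = 1 by rewrite expg1n.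
  by apply: bijP => b /=; rewrite negbK.
have g_word v : bij_fun (g (phi v)) false = odd (size v).
  elim: v => [|i v IH].
    rewrite word_val_nil.
    have -> : g 1 = 1 by apply: (mulgI (g 1)); rewrite -gmulfM !mulg1.
    by [].
  by rewrite word_val_cons gmulfM gs /= IH.
by have [v vu <-] := lenP (phi u); rewrite -!g_word vu.
Qed.

Lemma odd_len_mulgen w i : odd (len (w * s i)) = ~~ odd (len w).
Proof.
have [u <- _] := lenP w.
by rewrite -word_val_rcons !odd_len_word size_rcons.
Qed.

Lemma len_left w i : len (s i * w) = len (w^-1 * s i).
Proof. by rewrite -lenV invgM gen_inv. Qed.

Lemma len_braid_le p q : (len (s p * s q * s p) <= 3)%N.
Proof.
have := len_mul (s p * s q) (s p); have := len_mul (s p) (s q).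
have := len_gen_le p; have := len_gen_le q; lia.
Qed.

Definition right_descent w i := (len (w * s i) < len w)%N.

Lemma right_descentE w i :
  len (w * s i) = (if right_descent w i then (len w).-1 else (len w).+1).
Proof.
have le1 := len_mul w (s i); have le2 := len_mul (w * s i) (s i).
rewrite genK in le2; have si := len_gen_le i.
have := odd_len_mulgen w i; rewrite /right_descent.
have [->|ne _] := eqVneq (len (w * s i)) (len w); first by case: (odd _).
by case: ltnP; lia.
Qed.

Lemma right_descent_len w i : right_descent w i -> len w = (len (w * s i)).+1.
Proof.
by move=> d; rewrite right_descentE d prednK //; apply: leq_ltn_trans d.
Qed.

Lemma right_descentM w i : right_descent (w * s i) i = ~~ right_descent w i.
Proof.
have := right_descentE w i; rewrite /right_descent genK.
case: ltnP => /=; last by move=> _ ->; rewrite ltnS leqnn.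
by move=> /ltnW; rewrite leqNgt => /negbTE.
Qed.

Lemma ex_right_descent w : w <> 1 -> exists i, right_descent w i.
Proof.
have [u <- su] := lenP w.
case/lastP: u su => [|u i] su; first by rewrite word_val_nil.
move=> _; exists i; rewrite /right_descent -su size_rcons word_val_rcons genK.
by rewrite ltnS len_word.
Qed.

End Length.

(** * The Coxeter form and simple reflections *)

Section Form.
Local Open Scope ring_scope.
Context (R : realType) (I : finType) (m : I -> I -> nat).
Hypotheses (hm : coxeter_matrix m) (hsl : simply_laced m).
Local Notation V := (root_space R I).
Local Notation alpha := (@simple_root R I).
Local Notation refl := (@reflection R I m).

(** Twice the Coxeter form: the normalization in which roots have norm 2 and
   simple roots have integral pairings. *)
Definition pairing (x y : V) : R := 2 * coxeter_form m x y.
Local Notation "<< x , y >>" := (pairing x y).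

Lemma pairingC x y : <<x, y>> = <<y, x>>.
Proof.
congr (2 * _); rewrite /coxeter_form exchange_big /=.
apply: eq_bigr => i _; apply: eq_bigr => j _; have [_ mS _] := hm.
by rewrite (mS j i); congr (_ * _); apply: mulrC.
Qed.

Lemma pairingDl x y z : <<x + y, z>> = <<x, z>> + <<y, z>>.
Proof. by rewrite /pairing coxeter_formDl mulrDr. Qed.

Lemma pairingZl (a : R) x z : <<a *: x, z>> = a * <<x, z>>.
Proof. by rewrite /pairing coxeter_formZl mulrCA. Qed.

Lemma pairingNl x z : <<- x, z>> = - <<x, z>>.
Proof. by rewrite -scaleN1r pairingZl mulN1r. Qed.

Lemma pairingDr x y z : <<z, x + y>> = <<z, x>> + <<z, y>>.
Proof. by rewrite pairingC pairingDl !(pairingC z). Qed.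

Lemma pairingZr (a : R) x z : <<z, a *: x>> = a * <<z, x>>.
Proof. by rewrite pairingC pairingZl (pairingC z). Qed.

Lemma pairingNr x z : <<z, - x>> = - <<z, x>>.
Proof. by rewrite pairingC pairingNl (pairingC z). Qed.

Lemma pairing0l z : <<0, z>> = 0.
Proof. by rewrite -(scale0r (0 : V)) pairingZl mul0r. Qed.

Definition pairingE :=
  (pairingDl, pairingDr, pairingNl, pairingNr, pairingZl, pairingZr).

Lemma pairing_simple i j :
  <<alpha i, alpha j>> =
    (if i == j then 2 else if m i j == 2%N then 0 else -1) /\
  (i != j -> m i j != 2%N -> m i j = 3%N).
Proof.
rewrite /pairing coxeter_form_simple; have [m1 _ _] := hm.
have [<-|ij] := eqVneq i j; first by rewrite m1 divr1 cospi opprK mulr1.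
have [->|->] := hsl ij; split=> //=; first by rewrite cos_pihalf oppr0 mulr0.
by rewrite cos_pi3; field.
Qed.

Lemma pairing_simple_diag i : <<alpha i, alpha i>> = 2.
Proof. by have [->] := pairing_simple i i; rewrite eqxx. Qed.

Lemma pairing_simpleP i j : i != j ->
  m i j = 2%N /\ <<alpha i, alpha j>> = 0 \/
  m i j = 3%N /\ <<alpha i, alpha j>> = -1.
Proof.
move=> ij; have [-> h] := pairing_simple i j; rewrite (negbTE ij).
by have [->|n2] := eqVneq (m i j) 2%N; [left | right; rewrite h].
Qed.

Lemma reflE i v : refl i v = v - <<v, alpha i>> *: alpha i.
Proof. by []. Qed.

Lemma refl_isometry i x y : <<refl i x, refl i y>> = <<x, y>>.
Proof.
rewrite !reflE !pairingE pairing_simple_diag (pairingC (alpha i) y); ring.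
Qed.

Lemma reflD i x y : refl i (x + y) = refl i x + refl i y.
Proof. by rewrite !reflE pairingDl scalerDl opprD addrACA. Qed.

Lemma reflZ i (a : R) x : refl i (a *: x) = a *: refl i x.
Proof. by rewrite !reflE pairingZl scalerBr scalerA. Qed.

Lemma reflN i x : refl i (- x) = - refl i x.
Proof. by rewrite -(scaleN1r x) reflZ scaleN1r. Qed.

Lemma refl_adjacent i j : <<alpha i, alpha j>> = -1 ->
  refl i (alpha j) = alpha i + alpha j.
Proof. by move=> e; rewrite reflE pairingC e scaleN1r opprK addrC. Qed.

Lemma refl_adjacentD i j : <<alpha i, alpha j>> = -1 ->
  refl i (alpha i + alpha j) = alpha j.
Proof. by move=> /refl_adjacent <-; apply: (reflectionK hm). Qed.

Lemma alphaE i j : alpha i j = (j == i)%:R.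
Proof. by rewrite ffunE. Qed.

Lemma simple_root_inj : injective alpha.
Proof.
move=> i j /ffunP/(_ i); rewrite !alphaE eqxx; case: eqP => // _ /eqP.
by rewrite oner_eq0.
Qed.

Lemma refl_coord i j v : j != i -> refl i v j = v j.
Proof. by move=> ji; rewrite reflE !ffunE (negbTE ji) scaler0 subr0. Qed.

(** Applied to roots, whose coordinates are integers, this leaves only the
   values -1, 0 and 1 between the bounds -2 and 2. *)
Lemma pairing_int (v : V) i :
  (forall j, (v j : R) \is a Num.int) -> <<v, alpha i>> \is a Num.int.
Proof.
move=> vi.
have -> : v = \sum_j (v j : R) *: alpha j.
  apply/ffunP => k; rewrite sum_ffunE (bigD1 k) //= big1 => [|j jk].
    by rewrite !ffunE eqxx addr0 /GRing.scale /= mulr1.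
  by rewrite !ffunE eq_sym (negbTE jk) scaler0.
apply: (@big_ind _ (fun x => <<x, alpha i>> \is a Num.int)).
- by rewrite pairing0l int_num0.
- by move=> x y hx hy; rewrite pairingDl rpredD.
- move=> j _; rewrite pairingZl; apply: rpredM => //.
  have [-> _] := pairing_simple j i.
  case: ifP => _; first exact: (@intr_int R 2).
  by case: ifP => _; [exact: int_num0 | exact: (@intr_int R (-1))].
Qed.

Lemma refl_int i (v : V) : (forall j, (v j : R) \is a Num.int) ->
  forall j, (refl i v j : R) \is a Num.int.
Proof.
move=> vi j; rewrite reflE !ffunE /GRing.scale /=; apply: rpredB => //.
by apply: rpredM; [exact: pairing_int | exact: (@natr_int R)].
Qed.

Definition nonneg (v : V) : Prop := forall i, 0 <= (v i : R).

Lemma nonneg_alpha i : nonneg (alpha i).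
Proof. by move=> j; rewrite alphaE ler0n. Qed.

Lemma nonnegD u v : nonneg u -> nonneg v -> nonneg (u + v).
Proof. by move=> hu hv j; rewrite ffunE addr_ge0. Qed.

Lemma nonneg_anti v : nonneg v -> nonneg (- v) -> v = 0.
Proof.
move=> h h'; apply/ffunP => j; rewrite !ffunE; apply/eqP.
by rewrite eq_le h andbT; have := h' j; rewrite ffunE oppr_ge0.
Qed.

End Form.

(** * Roots and signs *)

Section Roots.
Local Open Scope ring_scope.
Context (R : realType) (I : finType) (m : I -> I -> nat).
Context (W : groupType) (s : I -> W).
Hypotheses (hm : coxeter_matrix m) (hsl : simply_laced m).
Hypothesis hW : coxeter_system m s.
Local Notation V := (root_space R I).
Local Notation alpha := (@simple_root R I).
Local Notation "<< x , y >>" := (pairing m x y).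
Local Notation act := (@Defs.act R I m W s).
Local Notation len := (len hW).
Local Notation desc := (right_descent hW).

Lemma actMs w i v : act (w * s i)%g v = act w (reflection m i v).
Proof. by rewrite Defs.actM // act_gen. Qed.

Lemma actD w x y : act w (x + y) = act w x + act w y.
Proof.
have [u <-] := coxeter_gen hW w; rewrite !act_word //.
by elim: u => //= i u ->; rewrite reflD.
Qed.

Lemma actZ w (a : R) x : act w (a *: x) = a *: act w x.
Proof.
have [u <-] := coxeter_gen hW w; rewrite !act_word //.
by elim: u => //= i u ->; rewrite reflZ.
Qed.

Lemma actN w x : act w (- x) = - act w x.
Proof. by rewrite -(scaleN1r x) actZ scaleN1r. Qed.

Lemma act_isometry w x y : <<act w x, act w y>> = <<x, y>>.
Proof.
have [u <-] := coxeter_gen hW w; rewrite !act_word //.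
by elim: u => //= i u IH; rewrite refl_isometry.
Qed.

Lemma actinvK w x : act w^-1 (act w x) = x.
Proof. by rewrite -Defs.actM // mulVg Defs.act1. Qed.

Lemma actKinv w x : act w (act w^-1 x) = x.
Proof. by rewrite -Defs.actM // mulgV Defs.act1. Qed.

(** The key positivity theorem: lengthening on the right by [s i] is detected
   by the sign of the image of the simple root. A descent [t] of [w] different
   from [i] is split off; as [s i] and [s t] generate a group of order 4 or 6,
   at most three letters have to be split off before the induction
   hypothesis applies. *)
Lemma ascent_nonneg w i : ~~ desc w i -> nonneg (act w (alpha i)).
Proof.
have [n le_n] := ubnP (len w); elim: n w i le_n => // n IH w i le_n asc.
have [->|/eqP/(ex_right_descent hm hW) [t dt]] := eqVneq w 1%g.
  by rewrite Defs.act1 //; apply: nonneg_alpha.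
have ti : i != t by apply: contraNneq asc => ->.
pose w1 := (w * s t)%g.
have w1E : w = (w1 * s t)%g by rewrite (genK hm hW).
have l1 : len w = (len w1).+1 by rewrite -(right_descent_len hm).
have asc1 : ~~ desc w1 t by rewrite (right_descentM hm) negbK.
have le1 : (len w1 < n)%N by rewrite -ltnS -l1.
clearbody w1.
have [[m2 p0]|[m3 p1]] := pairing_simpleP R hm hsl ti.
  have cit := gen_commute hm hW m2.
  have asc' : ~~ desc w1 i.
    apply: contra asc => /(right_descent_len hm) l2.
    rewrite /right_descent w1E -mulgA -cit mulgA.
    apply: leq_ltn_trans (len_mul hW _ _) _.
    by rewrite -w1E l1 l2 -[X in (_ < X)%N]addn2 ltn_add2l ltnS len_gen_le.
  rewrite w1E actMs reflE p0 scale0r subr0; exact: IH.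
have braid := gen_braid hm hW m3.
have wE : act w (alpha i) = act w1 (alpha i) + act w1 (alpha t).
  by rewrite w1E actMs refl_adjacent ?actD 1?addrC // (pairingC hm).
have [d1|asc1'] := boolP (desc w1 i); last first.
  by rewrite wE; apply: nonnegD; apply: IH.
pose w2 := (w1 * s i)%g.
have w2E : w1 = (w2 * s i)%g by rewrite (genK hm hW).
have l2 : len w1 = (len w2).+1 by rewrite -(right_descent_len hm).
clearbody w2.
have -> : act w (alpha i) = act w2 (alpha t).
  by rewrite wE -actD w2E actMs refl_adjacentD.
apply: IH; first by lia.
apply: contra asc => /(right_descent_len hm) l3.
rewrite /right_descent w1E w2E -!mulgA.
pose w3 := (w2 * s t)%g.
have -> : (w2 * (s i * (s t * s i)) = w3 * s i * s t)%g.
  by rewrite (mulgA (s i)) braid !mulgA.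
apply: leq_ltn_trans (len_mul hW _ _) _.
have := len_mul hW w3 (s i); have := len_gen_le hW t; have := len_gen_le hW i.
by rewrite mulgA -w2E -w1E l1 l2 l3 /w3; lia.
Qed.

Lemma descent_nonpos w i : desc w i -> nonneg (- act w (alpha i)).
Proof.
move=> d; have /ascent_nonneg : ~~ desc (w * s i)%g i.
  by rewrite (right_descentM hm) negbK.
rewrite actMs reflE pairing_simple_diag //.
have -> : alpha i - 2 *: alpha i = - alpha i.
  by rewrite scaler_nat mulr2n opprD addrA subrr sub0r.
by rewrite actN.
Qed.

Local Notation root := (@Defs.roots R I m W s).

Lemma root_alpha i : root (alpha i).
Proof. by exists 1%g, i; rewrite Defs.act1. Qed.

Lemma root_act w v : root v -> root (act w v).
Proof. by case=> [x [i ->]]; exists (w * x)%g, i; rewrite Defs.actM. Qed.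

Lemma root_refl i v : root v -> root (reflection m i v).
Proof. by move=> rv; rewrite -(act_gen hm hsl hW); apply: root_act. Qed.

Lemma refl_alpha i : reflection m i (alpha i) = - alpha i.
Proof.
rewrite reflE pairing_simple_diag // scaler_nat mulr2n opprD addrA.
by rewrite subrr sub0r.
Qed.

Lemma root_opp v : root v -> root (- v).
Proof.
case=> w [i ->]; rewrite -actN -refl_alpha.
by apply: root_act; apply: root_refl; apply: root_alpha.
Qed.

Lemma root_norm v : root v -> <<v, v>> = 2.
Proof. by case=> w [i ->]; rewrite act_isometry pairing_simple_diag. Qed.

Lemma root_int v : root v -> forall j, (v j : R) \is a Num.int.
Proof.
case=> w [i ->]; have [u <-] := coxeter_gen hW w; rewrite act_word //.
elim: u => [|k u IH] j /=; last exact: refl_int.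
by rewrite alphaE; apply: (@natr_int R).
Qed.

Lemma root_neq0 v : root v -> v <> 0.
Proof. by move/root_norm => h v0; move: h; rewrite v0 pairing0l; lra. Qed.

Lemma root_sign v : root v -> nonneg v \/ nonneg (- v).
Proof.
case=> w [i ->]; have [/descent_nonpos|/ascent_nonneg] := boolP (desc w i).
  by right.
by left.
Qed.

Lemma nonneg_not v : root v -> nonneg v -> nonneg (- v) -> False.
Proof. by move=> rv h h'; apply: root_neq0 rv _; apply: nonneg_anti. Qed.

Lemma descentP w i : reflect (nonneg (- act w (alpha i))) (desc w i).
Proof.
apply: (iffP idP) => [/descent_nonpos //|h]; apply: contraPT h.
move=> /ascent_nonneg h' h; apply: nonneg_not h; last exact: h'.
by apply: root_act; apply: root_alpha.
Qed.

(** [s i] permutes the positive roots other than [alpha i]: it modifies a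
   single coordinate, and a positive root whose only nonzero coordinate is the
   [i]-th one is [alpha i]. *)
Lemma refl_nonneg i v : root v -> nonneg v -> v <> alpha i ->
  nonneg (reflection m i v).
Proof.
move=> rv pv vi; have [//|neg] := root_sign (root_refl i rv); case: vi.
have v0 j : j != i -> v j = 0.
  move=> ji; apply/eqP; rewrite eq_le pv andbT.
  by have := neg j; rewrite ffunE refl_coord // oppr_ge0.
have vE : v = (v i : R) *: alpha i.
  apply/ffunP => j; rewrite ffunE alphaE /GRing.scale /=.
  by have [->|ji] := eqVneq j i; rewrite ?mulr1 // v0 // mulr0.
have ci := pv i; move: (v i : R) ci vE => c ci vE.
have : c ^+ 2 = 1.
  have := root_norm rv; rewrite vE pairingZl (pairingC hm) pairingZl.
  by rewrite pairing_simple_diag // expr2; lra.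
move/eqP; rewrite sqrf_eq1 => /orP[/eqP h|/eqP h].
  by rewrite vE h scale1r.
by move: ci; rewrite h oppr_ge0 ler10.
Qed.

(** The only way finiteness of the group enters. In affine type A2, a simple
   root and its sum with the null root have pairing 2, and the theorem fails:
   no braid move applies to the reduced word [j z x j z], but deleting [x] from
   it leaves a word that is not reduced. *)
Definition small_pairings : Prop := forall (a : V) (i : I), root a ->
  a <> alpha i -> a <> - alpha i ->
  [\/ <<alpha i, a>> = -1, <<alpha i, a>> = 0 | <<alpha i, a>> = 1].

End Roots.

(** * Pairings of roots in a finite group *)

Section FiniteForm.
Local Open Scope ring_scope.
Context (R : realType) (I : finType) (m : I -> I -> nat).
Context (W : finGroupType) (s : I -> W).
Hypotheses (hm : coxeter_matrix m) (hsl : simply_laced m).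
Hypothesis hW : coxeter_system m s.
Local Notation V := (root_space R I).
Local Notation alpha := (@simple_root R I).
Local Notation "<< x , y >>" := (pairing m x y).
Local Notation act := (@Defs.act R I m W s).
Local Notation root := (@Defs.roots R I m W s).

Let dot (x y : V) : R := \sum_i (x i : R) * (y i : R).

(** The average over the group of the standard scalar product: an invariant,
   positive definite form. It need not be proportional to [pairing] when the
   Coxeter graph is disconnected. *)
Definition avg_form (x y : V) : R := \sum_(w : W) dot (act w x) (act w y).
Local Notation Q := avg_form.

Let dotDl x y z : dot (x + y) z = dot x z + dot y z.
Proof.
by rewrite -big_split; apply: eq_bigr => i _; rewrite ffunE mulrDl.
Qed.

Let dotZl (a : R) x z : dot (a *: x) z = a * dot x z.
Proof.
by rewrite mulr_sumr; apply: eq_bigr => i _; rewrite ffunE -mulrA.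
Qed.

Lemma avg_formC x y : Q x y = Q y x.
Proof. by apply: eq_bigr => w _; apply: eq_bigr => i _; apply: mulrC. Qed.

Lemma avg_formDl x y z : Q (x + y) z = Q x z + Q y z.
Proof.
by rewrite -big_split; apply: eq_bigr => w _; rewrite (actD hm hsl hW) dotDl.
Qed.

Lemma avg_formZl (a : R) x z : Q (a *: x) z = a * Q x z.
Proof.
by rewrite mulr_sumr; apply: eq_bigr => w _; rewrite (actZ hm hsl hW) dotZl.
Qed.

Lemma avg_form_act g x y : Q (act g x) (act g y) = Q x y.
Proof.
rewrite /Q [RHS](reindex_inj (mulIg g)) /=.
by apply: eq_bigr => w _; rewrite !Defs.actM.
Qed.

Lemma avg_form_ge0 x : 0 <= Q x x.
Proof. by apply: sumr_ge0 => w _; apply: sumr_ge0 => i _; apply: sqr_ge0. Qed.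

Lemma avg_form_eq0 x : Q x x = 0 -> x = 0.
Proof.
move=> q0; apply/ffunP => i; rewrite ffunE.
have d0 w : 0 <= dot (act w x) (act w x).
  by apply: sumr_ge0 => j _; apply: sqr_ge0.
have /eqP : dot (act 1%g x) (act 1%g x) == 0.
  have := q0 => /eqP; rewrite psumr_eq0 // => /allP/(_ 1%g); apply.
  exact: mem_index_enum.
rewrite Defs.act1 // => /eqP; rewrite psumr_eq0 => [|j _]; last exact: sqr_ge0.
by move=> /allP/(_ i (mem_index_enum _)) /=; rewrite mulf_eq0 orbb => /eqP.
Qed.

(** The reflection in [a] preserves the averaged form, so its fixed hyperplane
   is the orthogonal of [a] for both forms. *)
Lemma pairing_avg x a : root a -> <<x, a>> * Q a a = 2 * Q x a.
Proof.
case=> w [i ->]; have -> : x = act w (act w^-1%g x) by rewrite (actKinv hm hsl hW).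
rewrite act_isometry // !avg_form_act; set y := act _ x.
have := avg_form_act (s i) y (alpha i); rewrite !act_gen // refl_alpha //.
rewrite reflE -[- alpha i]scaleN1r avg_formDl -scaleNr avg_formZl.
rewrite ![Q _ (-1 *: _)]avg_formC !avg_formZl (avg_formC (alpha i) y).
lra.
Qed.

(** For roots [a], [b] of pairing [c], the averaged form takes the value
   [(2 - c) * Q a a] at [a - b]: positive definiteness bounds the pairing. *)
Lemma pairing_le2 a b : root a -> root b ->
  <<a, b>> <= 2 /\ (<<a, b>> = 2 -> a = b).
Proof.
move=> ra rb; have h1 := pairing_avg a rb; have h2 := pairing_avg b ra.
rewrite (pairingC hm b) (avg_formC b) in h2.
have qa : 0 < Q a a.
  by rewrite lt0r avg_form_ge0 andbT; apply/eqP => /avg_form_eq0; apply: root_neq0 ra.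
have qab : Q (a - b) (a - b) = Q a a + Q b b - 2 * Q a b.
  rewrite -scaleN1r avg_formDl avg_formZl ![Q _ (a + _)]avg_formC.
  by rewrite !avg_formDl !avg_formZl (avg_formC b a); ring.
have [c0|c0] := eqVneq <<a, b>> 0.
  by rewrite c0; split=> [|e]; [lra | exfalso; lra].
have qE : Q a a = Q b b by apply: (mulfI c0); lra.
have qc : Q (a - b) (a - b) = (2 - <<a, b>>) * Q a a by rewrite qab -h1 -qE; ring.
split=> [|c2].
  by have := avg_form_ge0 (a - b); rewrite qc pmulr_lge0 // subr_ge0.
apply/subr0_eq/avg_form_eq0; rewrite qc c2; ring.
Qed.

Lemma pairing_geN2 a b : root a -> root b ->
  -2 <= <<a, b>> /\ (<<a, b>> = -2 -> a = - b).
Proof.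
move=> ra rb; have [] := pairing_le2 ra (root_opp hm hsl hW rb).
rewrite pairingNr // => le2 eq2; split=> [|e]; first by lra.
by apply: eq2; lra.
Qed.

Lemma finite_small_pairings : small_pairings R m s.
Proof.
move=> a i ra n1 n2; have ri := root_alpha R hm hsl hW i.
have [le2 e2] := pairing_le2 ra ri; have [ge2 e2'] := pairing_geN2 ra ri.
rewrite (pairingC hm (alpha i)).
have lt2 : <<a, alpha i>> < 2 by rewrite lt_neqAle le2 andbT; apply/eqP => /e2.
have gt2 : -2 < <<a, alpha i>>.
  by rewrite lt_neqAle ge2 andbT; apply/eqP => /esym/e2'.
have /intrP [z zE] := pairing_int hm hsl i (root_int hm hsl hW ra).
rewrite zE in lt2 gt2 *.
have lt2' : (z < 2)%R by rewrite -(ltr_int R).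
have gt2' : (-2 < z)%R by rewrite -(ltr_int R).
have [->|[->|->]] : z = -1 \/ z = 0 \/ z = 1 by lia.
- by constructor 1.
- by constructor 2.
- by constructor 3.
Qed.

End FiniteForm.

(** * Inversion triples are contractible *)

Section Contraction.
Local Open Scope ring_scope.
Context (R : realType) (I : finType) (m : I -> I -> nat).
Context (W : groupType) (s : I -> W).
Hypotheses (hm : coxeter_matrix m) (hsl : simply_laced m).
Hypothesis hW : coxeter_system m s.
Local Notation V := (root_space R I).
Local Notation alpha := (@simple_root R I).
Local Notation refl := (@reflection R I m).
Local Notation "<< x , y >>" := (pairing m x y).
Local Notation act := (@Defs.act R I m W s).
Local Notation root := (@Defs.roots R I m W s).
Local Notation len := (len hW).
Local Notation desc := (right_descent hW).
Hypothesis small : small_pairings R m s.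
Local Notation inv w v := (inversion_set m s w v).

Lemma inversionE (w : W) (v : V) :
  inv w v <-> [/\ root v, nonneg v & nonneg (- act w v)].
Proof.
split=> [[[rv pv] [_ nv]] //|[rv pv nv]].
by split=> //; split=> //; apply: root_opp => //; apply: root_act.
Qed.

Lemma root_neq_opp (v : V) i : root v -> nonneg v -> v <> - alpha i.
Proof.
move=> rv pv e; apply: (nonneg_not hm hsl hW rv pv).
by rewrite e opprK; apply: nonneg_alpha.
Qed.

Lemma sum_root_pairing (c d : V) :
  root c -> root d -> root (c + d) -> <<c, d>> = -1.
Proof.
move=> /(root_norm hm hsl hW) rc /(root_norm hm hsl hW) rd.
move=> /(root_norm hm hsl hW); rewrite !pairingE // rc rd (pairingC hm d); lra.
Qed.

Lemma sub_simple_root (v : V) i :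
  root v -> <<v, alpha i>> = 1 -> root (v - alpha i).
Proof.
by move=> rv e; have := root_refl hm hsl hW i rv; rewrite reflE e scale1r.
Qed.

Lemma add_simple_root (v : V) i :
  root v -> <<v, alpha i>> = -1 -> root (v + alpha i).
Proof.
move=> rv e; have := root_refl hm hsl hW i rv.
by rewrite reflE e scaleN1r opprK.
Qed.

Lemma inv_right (w : W) i (v : V) : inv w v -> v <> alpha i ->
  inv (w * s i)%g (refl i v).
Proof.
move=> /inversionE [rv pv nv] vi; apply/inversionE; split.
- exact: root_refl.
- exact: (refl_nonneg hm hsl hW).
- by rewrite actMs // (reflectionK hm).
Qed.

Lemma inv_left (w : W) i (v : V) : inv w v -> act w v <> - alpha i ->
  inv (s i * w)%g v.
Proof.
move=> /inversionE [rv pv nv] vi; apply/inversionE; split=> //.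
rewrite Defs.actM // act_gen // -(act_gen hm hsl hW) -actN // act_gen //.
apply: (refl_nonneg hm hsl hW) => //; first by apply: root_opp => //; apply: root_act.
by move/(congr1 -%R); rewrite opprK.
Qed.

Lemma inv_simple (w : W) i : inv w (alpha i) <-> desc w i.
Proof.
split=> [/inversionE [_ _ n]|d]; first exact/(descentP R hm hsl).
apply/inversionE; split; [exact: root_alpha | exact: nonneg_alpha |].
exact/(descentP R hm hsl).
Qed.

Lemma inv1 (v : V) : ~ inv 1%g v.
Proof. by move=> /inversionE []; rewrite Defs.act1 //; apply: nonneg_not. Qed.

(** The triple [{c, d, c + d}] comes from consecutive letters [p q p] of a
   reduced expression of [w], with [c] the root of the last one, which is
   crossed first. The inequality on lengths says that reduced expressions of
   the three factors concatenate to a reduced one. *)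
Definition contracts (w : W) (c d : V) : Prop :=
  exists (x y : W) (p q : I),
    [/\ m p q = 3%N, w = (x * (s p * s q * s p) * y)%g,
        (len x + 3 + len y <= len w)%N,
        c = act y^-1%g (alpha p) & d = act y^-1%g (alpha q)].

(** The braid relation reverses the order in which the triple is crossed. *)
Lemma contractsC w c d : contracts w c d -> contracts w d c.
Proof.
move=> [x [y [p [q [m3 wE lw cE dE]]]]]; exists x, y, q, p; split=> //.
  by have [_ -> _] := hm.
by rewrite -(gen_braid hm hW m3).
Qed.

Lemma contracts_right w z c d : desc w z -> contracts (w * s z)%g c d ->
  contracts w (refl z c) (refl z d).
Proof.
move=> dz [x [y [p [q [m3 wE lw -> ->]]]]].
exists x, (y * s z)%g, p, q; split=> //.
- by rewrite mulgA -wE (genK hm hW).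
- rewrite (right_descent_len hm dz).
  have := len_mul hW y (s z); have := len_gen_le hW z; lia.
- by rewrite invgM (gen_inv hm hW) Defs.actM // act_gen.
- by rewrite invgM (gen_inv hm hW) Defs.actM // act_gen.
Qed.

Lemma contracts_left w z c d : desc w^-1%g z -> contracts (s z * w)%g c d ->
  contracts w c d.
Proof.
move=> dz [x [y [p [q [m3 wE lw -> ->]]]]].
exists (s z * x)%g, y, p, q; split=> //.
- by rewrite -[LHS](genKl hm hW w z) wE !mulgA.
- have := right_descent_len hm dz; rewrite (lenV hm) -(len_left hm) => ->.
  have := len_mul hW (s z) x; have := len_gen_le hW z; lia.
Qed.

(** In a reduced expression of [g] containing the braid, [c] is the root of the
   third letter of the braid, so it is not the root of the leftmost letter of
   the expression, and [l] may be taken to be this letter. *)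
Lemma contracts_left_descent (g : W) (c d : V) : contracts g c d ->
  exists2 l, desc g^-1%g l & act g c <> - alpha l.
Proof.
move=> [x [y [p [q [m3 gE lg cE _]]]]].
have pq : p != q.
  by apply/eqP => e; move: m3; rewrite e; have [-> _ _] := hm.
have qpE : << alpha q, alpha p >> = -1.
  have [[]|[_]] := pairing_simpleP R hm hsl pq; first by rewrite m3.
  by rewrite (pairingC hm).
have -> : act g c = - act x (alpha q).
  rewrite cE gE Defs.actM // Defs.actM // actKinv // actMs // actMs //.
  rewrite act_gen // refl_alpha // !reflN refl_adjacent // addrC.
  by rewrite refl_adjacentD ?actN // (pairingC hm).
suff [l dl xl] : exists2 l, desc g^-1%g l & act x (alpha q) <> alpha l.
  by exists l => // /oppr_inj.
have [x1|/eqP x1] := eqVneq x 1%g.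
  exists p; last first.
    rewrite x1 Defs.act1 // => /simple_root_inj qp.
    by rewrite qp eqxx in pq.
  rewrite /right_descent -(len_left hm) (lenV hm) {1}gE x1 mul1g -!mulgA.
  rewrite (genKl hm hW).
  have := len_mul hW (s q * s p)%g y; have := len_mul hW (s q) (s p).
  have := len_gen_le hW p; have := len_gen_le hW q; rewrite -mulgA; lia.
have [l dl] : exists l, desc x^-1%g l.
  apply: (ex_right_descent hm hW) => x1V; apply: x1.
  by rewrite -(invgK x) x1V invg1.
exists l; last first.
  move=> xl; have := descent_nonpos R hm hsl dl; rewrite -xl actinvK //.
  exact/(nonneg_not hm hsl hW (root_alpha R hm hsl hW q))/nonneg_alpha.
move: dl; rewrite /right_descent -!(len_left hm) !(lenV hm).
have -> : (s l * g = s l * x * (s p * s q * s p) * y)%g by rewrite gE !mulgA.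
have := len_mul hW (s l * x * (s p * s q * s p))%g y.
have := len_mul hW (s l * x)%g (s p * s q * s p)%g.
have := len_braid_le hW p q; lia.
Qed.

(** Likewise [d] is the root of the first letter of the braid, hence not that of
   the rightmost letter [k] of the expression. *)
Lemma contracts_right_descent (g : W) (c d : V) : contracts g c d ->
  exists2 k, desc g k & d <> alpha k.
Proof.
move=> [x [y [p [q [m3 gE lg _ dE]]]]].
have [y1|/eqP /(ex_right_descent hm hW) [k dk]] := eqVneq y 1%g.
  exists p; last first.
    rewrite dE y1 invg1 Defs.act1 // => /simple_root_inj qp.
    by move: m3; rewrite qp; have [-> _ _] := hm.
  rewrite /right_descent.
  have -> : (g * s p = x * (s p * s q))%g.
    by rewrite gE y1 mulg1 -!mulgA (gen_sq hm hW) mulg1.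
  have := len_mul hW x (s p * s q)%g; have := len_mul hW (s p) (s q).
  have := len_gen_le hW p; have := len_gen_le hW q; lia.
exists k; last first.
  move=> dkE; have := descent_nonpos R hm hsl dk; rewrite -dkE dE actKinv //.
  exact/(nonneg_not hm hsl hW (root_alpha R hm hsl hW q))/nonneg_alpha.
move: dk; rewrite /right_descent.
have -> : (g * s k = x * (s p * s q * s p) * (y * s k))%g by rewrite gE !mulgA.
have := len_mul hW (x * (s p * s q * s p))%g (y * s k)%g.
have := len_mul hW x (s p * s q * s p)%g; have := len_braid_le hW p q; lia.
Qed.

(** What free braidedness implies for contractible triples with the same
   highest root; in this form it is inherited by [w * s z] and [s z * w] when
   these are shorter than [w]. *)
Definition unique_contraction (w : W) : Prop := forall c d c' d' : V,
  contracts w c d -> contracts w c' d' -> c + d = c' + d' ->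
  c = c' \/ c = d'.

Lemma unique_contraction_right w z : desc w z -> unique_contraction w ->
  unique_contraction (w * s z)%g.
Proof.
move=> dz uw c d c' d' h h' e.
have [] := uw _ _ _ _ (contracts_right dz h) (contracts_right dz h').
- by rewrite -!reflD // e.
- by move/(can_inj (reflectionK hm z)); left.
- by move/(can_inj (reflectionK hm z)); right.
Qed.

Lemma unique_contraction_left w z : desc w^-1%g z -> unique_contraction w ->
  unique_contraction (s z * w)%g.
Proof.
by move=> dz uw c d c' d' h h'; apply: uw; apply: contracts_left dz _.
Qed.

Section Step.
Variable (w : W).
Hypothesis uw : unique_contraction w.
Hypothesis IH : forall (w' : W) (c d : V), (len w' < len w)%N ->
  unique_contraction w' -> inv w' c -> inv w' d -> root (c + d) ->
  contracts w' c d.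

Lemma contracts_quotient_right z c d : desc w z -> inv w c -> inv w d ->
  root (c + d) -> c <> alpha z -> d <> alpha z ->
  contracts (w * s z)%g (refl z c) (refl z d).
Proof.
move=> dz ic id rcd cz dz'; apply: IH => //.
- exact: unique_contraction_right.
- exact: inv_right.
- exact: inv_right.
- by rewrite -reflD //; apply: root_refl.
Qed.

Lemma contracts_drop_right z c d : desc w z -> inv w c -> inv w d ->
  root (c + d) -> c <> alpha z -> d <> alpha z -> contracts w c d.
Proof.
move=> dz ic id rcd cz dz'.
rewrite -(reflectionK hm z c) -(reflectionK hm z d); apply: contracts_right => //.
exact: contracts_quotient_right.
Qed.

Lemma contracts_drop_left z c d : desc w^-1%g z -> inv w c -> inv w d ->
  root (c + d) -> act w c <> - alpha z -> act w d <> - alpha z ->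
  contracts w c d.
Proof.
move=> dz ic id rcd cz dz'.
apply: (contracts_left dz); apply: IH => //.
- by rewrite (len_left hm hW) -(lenV hm hW w).
- exact: unique_contraction_left.
- exact: inv_left.
- exact: inv_left.
Qed.

Variables (z : I) (c : V).
Hypotheses (dz : desc w z) (ic : inv w c) (rcz : root (c + alpha z)).

Let rc : root c. Proof. by have /inversionE[] := ic. Qed.
Let pc : nonneg c. Proof. by have /inversionE[] := ic. Qed.
Let cz : <<c, alpha z>> = -1.
Proof. by apply: sum_root_pairing => //; apply: root_alpha. Qed.

(** The case analysis on a right descent [k] of [w * s z]. The second
   alternative records the contractible triple of [c - alpha k] and
   [alpha k + alpha z], moved to [w * s z] by [s z], which fixes the former and
   maps the latter to [alpha k]. *)
Lemma contraction_step k : desc (w * s z)%g k ->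
  contracts w c (alpha z) \/
  << alpha k, alpha z >> = -1 /\ contracts (w * s z)%g (c - alpha k) (alpha k).
Proof.
move=> dk.
have kz : k != z by apply: contraTneq dk => ->; rewrite right_descentM // dz.
have akz : alpha k <> alpha z by move/simple_root_inj => e; rewrite e eqxx in kz.
have [dwk|dwk] := boolP (desc w k).
  left; have [ck|ck] := pselect (c = alpha k); last first.
    by apply: (@contracts_drop_right k) => //; [exact/inv_simple | exact/nesym].
  have [[_ h]|[m3 h]] := pairing_simpleP R hm hsl kz.
    by move: cz; rewrite ck h; lra.
  have dzk : desc (w * s z * s k)%g z.
    apply/(descentP R hm hsl); rewrite !actMs // refl_adjacent // addrC.
    by rewrite refl_adjacentD 1?(pairingC hm) //; apply/(descentP R hm hsl).
  rewrite ck; apply: contractsC.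
  exists (w * s z * s k * s z)%g, 1%g, z, k; rewrite invg1 !Defs.act1 //; split=> //.
  - by have [_ -> _] := hm.
  - by rewrite mulg1 !mulgA !(genK hm hW).
  - rewrite len1 addn0 (right_descent_len hm dz) (right_descent_len hm dk).
    by rewrite (right_descent_len hm dzk) addn3.
have pwk := ascent_nonneg R hm hsl dwk.
have kzE : << alpha k, alpha z >> = -1.
  have [[_ h]|[_ //]] := pairing_simpleP R hm hsl kz.
  have /(descent_nonpos R hm hsl) := dk.
  rewrite actMs // reflE h scale0r subr0 => nwk.
  case: (nonneg_not hm hsl hW _ pwk nwk).
  by apply: root_act => //; apply: root_alpha.
have zkE : << alpha z, alpha k >> = -1 by rewrite (pairingC hm).
have ie : inv w (alpha z + alpha k).
  apply/inversionE; rewrite -(refl_adjacent hm zkE); split.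
  - by apply: root_refl => //; apply: root_alpha.
  - by rewrite refl_adjacent //; apply: nonnegD; apply: nonneg_alpha.
  - by rewrite -actMs //; apply/(descentP R hm hsl).
have ez : alpha z + alpha k <> alpha z.
  move=> e; apply: (root_neq0 hm hsl hW (root_alpha R hm hsl hW k)).
  by apply: (addrI (alpha z)); rewrite e addr0.
have ck : c <> alpha k.
  by move=> e; move: ic; rewrite e => /inv_simple; apply/negP.
have cz' : c <> alpha z.
  by move=> e; move: cz; rewrite e pairing_simple_diag //; lra.
have [e|e|e] := small rc ck (root_neq_opp rc pc).
- exfalso; have e2 : << alpha k, c + alpha z >> = -2.
    by rewrite pairingDr // e kzE; lra.
  have n1 : c + alpha z <> alpha k.
    by move=> h; move: e2; rewrite h pairing_simple_diag //; lra.
  have n2 : c + alpha z <> - alpha k.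
    by apply: root_neq_opp => //; apply: nonnegD => //; apply: nonneg_alpha.
  have [] := small rcz n1 n2; rewrite e2; lra.
  (* [refl z] maps [c] and [alpha z + alpha k] to the pair displayed here. *)
- left; have : contracts (w * s z)%g (refl z c) (alpha k).
    rewrite -(refl_adjacentD hm zkE); apply: contracts_quotient_right => //.
    rewrite addrA; apply: add_simple_root => //.
    by rewrite (pairingC hm) pairingDr // e kzE add0r.
  set g := (w * s z)%g => /contracts_left_descent [l dl gl].
  (* Both [c] and [alpha z] survive the removal of the left letter [l]. *)
  have dl' : desc w^-1%g l.
    move: dl; rewrite /right_descent -!(len_left hm) !(lenV hm).
    have <- : (s l * g * s z = s l * w)%g by rewrite -mulgA (genK hm hW).
    have := len_mul hW (s l * g)%g (s z); have := len_gen_le hW z.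
    rewrite (right_descent_len hm dz) -/g; lia.
  apply: (contracts_drop_left dl') => //.
  + exact/inv_simple.
  + have -> : act w c = act g (refl z c) by rewrite -actMs // (genK hm hW).
    exact: gl.
  + have -> : act w (alpha z) = - act g (alpha z).
      by rewrite actMs // refl_alpha // actN // opprK.
    move=> /oppr_inj gz; have := descent_nonpos R hm hsl dl; rewrite -gz actinvK //.
    exact/(nonneg_not hm hsl hW (root_alpha R hm hsl hW z))/nonneg_alpha.
- right; split=> //.
  have : contracts (w * s z)%g (refl z (c - alpha k))
      (refl z (alpha z + alpha k)).
    apply: contracts_quotient_right => //.
    + apply/inversionE; split.
      * by apply: sub_simple_root => //; rewrite (pairingC hm).
      * have <- : refl k c = c - alpha k by rewrite reflE (pairingC hm) e scale1r.
        exact: (refl_nonneg hm hsl hW).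
      * rewrite actD // actN // opprD opprK; apply: nonnegD => //.
        by have /inversionE[] := ic.
    + by rewrite addrA addrAC addrNK.
    + move/(congr1 (fun v => <<v, alpha z>>)).
      rewrite pairingDl // pairingNl // cz kzE pairing_simple_diag //; lra.
  have -> : refl z (c - alpha k) = c - alpha k.
    by rewrite reflE pairingDl // pairingNl // cz kzE subrr scale0r subr0.
  by rewrite refl_adjacentD.
Qed.

(** A first descent [j] either settles the matter or gives a contractible
   triple of [w * s z] with highest root [c] and with [alpha j] as one of its
   ends. Written with [alpha j] as its last root, it produces another descent
   [k]; were [k] to fail like [j], two such triples would exist. *)
Lemma contracts_descent : contracts w c (alpha z).
Proof.
have cz' : c <> alpha z.
  by move=> e; move: cz; rewrite e pairing_simple_diag //; lra.
have [j dj] : exists j, desc (w * s z)%g j.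
  apply: (ex_right_descent hm hW) => e; have := inv_right ic cz'.
  by rewrite e => /inv1.
have [//|[jz cj]] := contraction_step dj.
have [k dk kj] := contracts_right_descent cj.
have [//|[kz ck]] := contraction_step dk.
have [|h|h] := unique_contraction_right dz uw cj ck; first by rewrite !subrK.
  by case: kj; apply: oppr_inj; apply: (addrI c).
have := congr1 (fun v => <<v, alpha z>>) h.
by rewrite pairingDl // pairingNl // cz jz kz; lra.
Qed.
End Step.

(** If a right descent [z] has [alpha z] outside the triple, the induction
   hypothesis applies to [w * s z]; a simple root in the triple is [c] or [d],
   since it is not a sum of positive roots. *)
Theorem inversion_triple_contracts w c d : unique_contraction w ->
  inv w c -> inv w d -> root (c + d) -> contracts w c d.
Proof.
have [n le_n] := ubnP (len w).
elim: n w c d le_n => // n IHn w c d le_n uw ic id rcd.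
have IH w' c' d' : (len w' < len w)%N -> unique_contraction w' ->
    inv w' c' -> inv w' d' -> root (c' + d') -> contracts w' c' d'.
  by move=> lw; apply: IHn; apply: leq_trans lw _.
have [z dz] : exists z, desc w z.
  by apply: (ex_right_descent hm hW) => e; move: ic; rewrite e => /inv1.
have [cE|cz] := pselect (c = alpha z).
  rewrite cE; apply: contractsC; apply: contracts_descent => //.
  by rewrite addrC -cE.
have [dE|dz'] := pselect (d = alpha z); last first.
  exact: contracts_drop_right dz _ _ _ _ _.
by rewrite dE; apply: contracts_descent; rewrite -?dE.
Qed.

End Contraction.

(** * Root sequences and deletion of a letter *)

Section RootSequences.
Local Open Scope ring_scope.
Local Open Scope classical_set_scope.
Context (R : realType) (I : finType) (m : I -> I -> nat).
Context (W : groupType) (s : I -> W).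
Hypotheses (hm : coxeter_matrix m) (hsl : simply_laced m).
Hypothesis hW : coxeter_system m s.
Local Notation V := (root_space R I).
Local Notation alpha := (@simple_root R I).
Local Notation refl := (@reflection R I m).
Local Notation "<< x , y >>" := (pairing m x y).
Local Notation act := (@Defs.act R I m W s).
Local Notation root := (@Defs.roots R I m W s).
Local Notation len := (len hW).
Local Notation desc := (right_descent hW).
Local Notation phi := (word_val s).
Local Notation inv w v := (inversion_set m s w v).
Local Notation rseq := (@root_seq R I m).

Lemma reduced_cons i u :
  reduced s (i :: u) <-> reduced s u /\ ~~ desc (phi u)^-1%g i.
Proof.
rewrite !(reducedE hW) /right_descent -(len_left hm) word_val_cons -leqNgt.
rewrite (lenV hm) /=.
have := len_mul hW (s i) (phi u); have := len_gen_le hW i; have := len_word hW u.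
split; first by lia.
case=> -> h; have := right_descentE hm hW (phi u)^-1%g i.
by rewrite /right_descent -(len_left hm) (lenV hm) ltnNge h.
Qed.

Lemma reduced_suffix u v : reduced s (u ++ v) -> reduced s v.
Proof. by elim: u => //= i u IH /reduced_cons[/IH]. Qed.

Lemma reduced_prefix u v : reduced s (u ++ v) -> reduced s u.
Proof.
rewrite !(reducedE hW) word_val_cat size_cat.
have := len_mul hW (phi u) (phi v).
have := len_word hW u; have := len_word hW v; lia.
Qed.

Definition letter_root (u : seq I) (i : I) : V := act (phi u)^-1%g (alpha i).

Lemma letter_rootE u i : word_act m (rev u) (alpha i) = letter_root u i.
Proof. by rewrite /letter_root -(word_val_rev hm hW) act_word. Qed.

Lemma root_letter_root u i : root (letter_root u i).
Proof. by apply: root_act => //; apply: root_alpha. Qed.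

Lemma root_seq_cons i u : rseq (i :: u) = rcons (rseq u) (letter_root u i).
Proof. by rewrite /= letter_rootE. Qed.

Lemma letter_root_cat u v i :
  letter_root (u ++ v) i = act (phi v)^-1%g (letter_root u i).
Proof. by rewrite /letter_root word_val_cat invgM Defs.actM. Qed.

Lemma root_seq_cat u v :
  rseq (u ++ v) = rseq v ++ map (act (phi v)^-1%g) (rseq u).
Proof.
elim: u => [|i u IH]; first by rewrite cats0.
by rewrite cat_cons !root_seq_cons IH map_rcons letter_root_cat rcons_cat.
Qed.

Lemma letter_root_nonneg u i : reduced s (i :: u) -> nonneg (letter_root u i).
Proof. by case/reduced_cons => _ /(ascent_nonneg R hm hsl). Qed.

(** Prepending a letter [i] to a reduced word [u] adds one inversion,
   [letter_root u i]: any other positive root is sent by [u] to a root other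
   than [alpha i] and [- alpha i], whose sign [s i] preserves. *)
Lemma root_seq_inversions u : reduced s u ->
  uniq (rseq u) /\ forall v, v \in rseq u <-> inv (phi u) v.
Proof.
elim: u => [_|i u IH riu].
  by rewrite word_val_nil; split=> // v; split=> [|/(inv1 hm hsl hW)] //.
have [ru _] := iffLR (reduced_cons _ _) riu; have [uu mu] := IH ru.
have nn := letter_root_nonneg riu; have rr := root_letter_root u i.
rewrite root_seq_cons rcons_uniq uu andbT word_val_cons; split=> [|v].
  apply/negP => /mu /(inversionE hm hsl hW) [_ _]; rewrite /letter_root actKinv //.
  by apply: (nonneg_not hm hsl hW (root_alpha R hm hsl hW i)); apply: nonneg_alpha.
rewrite mem_rcons inE; split=> [/orP[/eqP ->|/mu iv]|iv].
- apply/(inversionE hm hsl hW); split=> //.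
  rewrite Defs.actM // actKinv // act_gen // refl_alpha // opprK.
  exact: nonneg_alpha.
- apply: inv_left => // e; have /(inversionE hm hsl hW)[_ nv _] := iv.
  apply: (nonneg_not hm hsl hW rr nn); move: nv.
  by rewrite /letter_root -actN // -e actinvK.
- have [e|e] := pselect (act (phi u) v = alpha i).
    by rewrite /letter_root -e actinvK // eqxx.
  apply/orP; right; apply/mu; rewrite -(genKl hm hW (phi u) i).
  apply: inv_left => //; rewrite Defs.actM // act_gen // => h; apply: e.
  by rewrite -(reflectionK hm i (act _ v)) h reflN refl_alpha // opprK.
Qed.

Lemma inv_letter_root u1 i u2 : reduced s (u1 ++ i :: u2) ->
  inv (phi (u1 ++ i :: u2)) (letter_root u2 i).
Proof.
move=> /root_seq_inversions [_ <-].
by rewrite root_seq_cat root_seq_cons mem_cat mem_rcons mem_head.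
Qed.

Lemma nonreduced_cat u v : reduced s v -> ~ reduced s (u ++ v) ->
  exists u1 i u2, u = u1 ++ i :: u2 /\ nonneg (- letter_root (u2 ++ v) i).
Proof.
move=> rv; elim: u => [|i u IH] //= nr.
have [ruv|nruv] := pselect (reduced s (u ++ v)); last first.
  have [u1 [j [u2 [-> h]]]] := IH nruv; by exists (i :: u1), j, u2.
exists [::], i, u; split=> //; apply/(descentP R hm hsl).
by apply/negPn/negP => h; apply: nr; apply/reduced_cons.
Qed.

(** Applying the letters of [u] to [v] one after another, the sign can change
   only where the current root is simple. *)
Lemma sign_change u v : root v -> nonneg v -> nonneg (- act (phi u)^-1%g v) ->
  exists u1 i u2, u = u1 ++ i :: u2 /\ act (phi u)^-1%g v = - letter_root u2 i.
Proof.
elim: u v => [|i u IH] v rv pv.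
  rewrite word_val_nil invg1 Defs.act1 // => nv.
  by case: (nonneg_not hm hsl hW rv pv nv).
rewrite word_val_cons invgM (gen_inv hm hW) Defs.actM // act_gen //.
have [->|vi] := pselect (v = alpha i).
  by rewrite refl_alpha // actN // => _; exists [::], i, u.
move=> nv; have [|||u1 [j [u2 [uE h]]]] := IH (refl i v) => //.
- exact: root_refl.
- exact: (refl_nonneg hm hsl hW).
- by exists (i :: u1), j, u2; rewrite h {1}uE.
Qed.

Lemma nonnegD_eq0 (x y : V) : nonneg x -> nonneg y -> x + y = 0 -> x = 0.
Proof.
move=> px py e; apply: nonneg_anti => //.
by have -> : - x = y by apply: (addrI x); rewrite subrr e.
Qed.

Hypothesis small : small_pairings R m s.

(** The letter [y] of [u] witnesses that [u ++ v] is not reduced, although its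
   own root is positive before [v] is applied; [z] is the letter of [v] at which
   the sign changes. Comparing with the word containing [x], the two roots add
   up to a multiple of [letter_root v x], and positivity forces the
   multiple to be 1. *)
Lemma deletion_triple u x v : reduced s (u ++ x :: v) -> ~ reduced s (u ++ v) ->
  exists c d, [/\ inv (phi (u ++ x :: v)) c, inv (phi (u ++ x :: v)) d
    & c + d = letter_root v x].
Proof.
move=> ri nr.
have [rv _] := iffLR (reduced_cons _ _) (reduced_suffix ri).
have [u1 [y [u2 [uE neg]]]] := nonreduced_cat rv nr.
have ic : inv (phi (u ++ x :: v)) (letter_root (u2 ++ x :: v) y).
  by rewrite uE -catA; apply: inv_letter_root; rewrite -cat_cons catA -uE.
have ir := inv_letter_root ri.
have g0 : nonneg (letter_root u2 y).
  apply: letter_root_nonneg; apply: (@reduced_suffix u1); rewrite -uE.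
  exact: reduced_prefix ri.
rewrite letter_root_cat in neg.
have [v1 [z [v2 [vE bE]]]] := sign_change (root_letter_root u2 y) g0 neg.
have id : inv (phi (u ++ x :: v)) (letter_root v2 z).
  have e : u ++ x :: v = (u ++ x :: v1) ++ z :: v2 by rewrite -catA vE.
  by rewrite e; apply: inv_letter_root; rewrite -e.
exists (letter_root (u2 ++ x :: v) y), (letter_root v2 z); split=> //.
have cE : letter_root (u2 ++ x :: v) y =
    act (phi v)^-1%g (refl x (letter_root u2 y)).
  rewrite letter_root_cat word_val_cons invgM (gen_inv hm hW) Defs.actM //.
  by rewrite act_gen.
have [_ pc _] := iffLR (inversionE hm hsl hW _ _) ic.
have [_ pd _] := iffLR (inversionE hm hsl hW _ _) id.
have [rr pr _] := iffLR (inversionE hm hsl hW _ _) ir.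
have sumE : letter_root (u2 ++ x :: v) y + letter_root v2 z =
    - << alpha x, letter_root u2 y >> *: letter_root v x.
  rewrite cE reflE actD // actN // actZ // bE (pairingC hm) -/(letter_root v x).
  by rewrite addrAC addNr add0r scaleNr.
have n1 : letter_root u2 y <> alpha x.
  move=> e; apply: (nonneg_not hm hsl hW rr pr).
  by have := pc; rewrite cE e refl_alpha // actN.
have n2 : letter_root u2 y <> - alpha x.
  by apply: (root_neq_opp hm hsl hW) => //; apply: root_letter_root.
have [] := small (root_letter_root u2 y) n1 n2.
- by move=> e; rewrite sumE e opprK scale1r.
- move=> e; move: sumE; rewrite e oppr0 scale0r => /(nonnegD_eq0 pc pd) c0.
  by case: (root_neq0 hm hsl hW (root_letter_root (u2 ++ x :: v) y)).
- move=> e; case: (nonneg_not hm hsl hW rr pr).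
  by rewrite -scaleN1r -e -sumE; apply: nonnegD.
Qed.

Lemma root_seq_braid p q : m p q = 3%N ->
  rseq [:: p; q; p] = [:: alpha p; alpha p + alpha q; alpha q].
Proof.
move=> m3; have pq : p != q.
  by apply/eqP => e; move: m3; rewrite e; have [-> _ _] := hm.
have [[]|[_ pqE]] := pairing_simpleP R hm hsl pq; first by rewrite m3.
have qpE : << alpha q, alpha p >> = -1 by rewrite (pairingC hm).
rewrite /= refl_adjacent // refl_adjacent // [alpha q + _]addrC.
by rewrite refl_adjacentD.
Qed.

Lemma braid_contractible u1 p q u2 : m p q = 3%N ->
  reduced s (u1 ++ [:: p; q; p] ++ u2) ->
  contractible m s (phi (u1 ++ [:: p; q; p] ++ u2))
    [set letter_root u2 p; letter_root u2 q;
         letter_root u2 p + letter_root u2 q].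
Proof.
move=> m3 ru; set w := phi _.
have rE : rseq (u1 ++ [:: p; q; p] ++ u2) = rseq u2 ++
   [:: letter_root u2 p; letter_root u2 p + letter_root u2 q; letter_root u2 q]
   ++ map (act (phi ([:: p; q; p] ++ u2))^-1%g) (rseq u1).
  by rewrite root_seq_cat [in LHS]root_seq_cat root_seq_braid //= actD // -catA.
have [_ mw] := root_seq_inversions ru.
split.
  split; last by exists (letter_root u2 p), (letter_root u2 q).
  by move=> v [[|]|] ->; apply/mw; rewrite rE !mem_cat !inE eqxx ?orbT.
exists (rseq (u1 ++ [:: p; q; p] ++ u2)).
  by exists (u1 ++ [:: p; q; p] ++ u2).
exists (letter_root u2 p), (letter_root u2 p + letter_root u2 q),
  (letter_root u2 q).
split; last by rewrite setUAC.
by rewrite rE; apply: infix_infix.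
Qed.

Lemma contracts_contractible w (c d : V) : contracts hW w c d ->
  contractible m s w [set c; d; c + d].
Proof.
move=> [x [y [p [q [m3 wE lw -> ->]]]]].
have [[u1 u1E su1] [u2 u2E su2]] := (lenP hW x, lenP hW y).
have wE' : w = phi (u1 ++ [:: p; q; p] ++ u2).
  rewrite !word_val_cat !word_val_cons word_val_nil u1E u2E wE.
  by rewrite !mulgA mulg1.
rewrite wE' -u2E; apply: braid_contractible => //.
apply/(reducedE hW); rewrite -wE'; apply/eqP.
rewrite eqn_leq {2}wE' len_word andbT !size_cat su1 su2 /=.
by rewrite addnA.
Qed.

(** If the sum of one pair were an element [c'] of the other pair, then [c']
   plus the positive root [d'] would be an element of the first triple,
   strictly larger than its highest root. *)
Lemma triple_sum_inj (c d c' d' : V) : root c -> root d -> root c' -> root d' ->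
  nonneg c -> nonneg d -> nonneg c' -> nonneg d' ->
  [set c; d; c + d] = [set c'; d'; c' + d'] -> c + d = c' + d'.
Proof.
move=> rc rd rc' rd' pc pd pc' pd' e.
have no x y : root x -> nonneg x -> nonneg y -> x + y <> 0.
  by move=> rx px py /(nonnegD_eq0 px py); apply: root_neq0 rx.
have : [set c'; d'; c' + d'] (c + d) by rewrite -e; right.
have : [set c; d; c + d] (c' + d') by rewrite e; right.
case=> [[|]|] //= h [[|]|] //= h'; exfalso.
- apply: (no d d') => //; apply: (addrI c).
  by rewrite addr0 addrA h' h.
- apply: (no d c') => //; apply: (addrI c).
  by rewrite addr0 addrA h' addrC h.
- apply: (no c d') => //; apply: (addrI d).
  by rewrite addr0 addrA [d + c]addrC h' h.
- apply: (no c c') => //; apply: (addrI d).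
  by rewrite addr0 addrA [d + c]addrC h' addrC h.
Qed.

Lemma freely_braided_unique w : freely_braided R m s w ->
  unique_contraction R hW w.
Proof.
move=> fb c d c' d' h h' e.
have [T1 T2] := (contracts_contractible h, contracts_contractible h').
have [E|ne] := pselect ([set c; d; c + d] = [set c'; d'; c' + d']); last first.
  have : ([set c; d; c + d] `&` [set c'; d'; c' + d']) (c + d).
    by split; [right | rewrite e; right].
  by rewrite (fb _ _ T1 T2 ne).
have : [set c'; d'; c' + d'] c by rewrite -E; left; left.
case=> [[|]|] /=; [by left | by right | rewrite -e => cE].
have [x [y [p [q [m3 _ _ _ dE]]]]] := h.
have : root d by rewrite dE; apply: root_act => //; apply: root_alpha.
by move/(root_neq0 hm hsl hW); case; apply: (addrI c); rewrite addr0 -cE.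
Qed.

Lemma size_root_seq u : size (rseq u) = size u.
Proof. by elim: u => //= i u IH; rewrite size_rcons IH. Qed.

Definition position_root (u : seq I) (k : nat) : V :=
  nth 0 (rseq u) (size u - k.+1).

Lemma position_rootE u i v :
  position_root (u ++ i :: v) (size u) = letter_root v i.
Proof.
rewrite /position_root size_cat /= -addSnnS addKn root_seq_cat.
rewrite root_seq_cons nth_cat size_rcons size_root_seq ltnS leqnn.
by rewrite nth_rcons size_root_seq ltnn eqxx.
Qed.

Lemma position_root_inj u : reduced s u ->
  {in gtn (size u) &, injective (position_root u)}.
Proof.
move=> /root_seq_inversions [uu _] k l; rewrite !inE => ku lu.
rewrite /position_root => /eqP; rewrite nth_uniq ?size_root_seq //; last first.
- by rewrite -subSn // subSS leq_subr.
- by rewrite -subSn // subSS leq_subr.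
by move=> /eqP; lia.
Qed.

(** * Counting the braids of a contracted expression *)

Section Braids.
Variables (u u0 : seq I) (bus : seq (seq I * seq I)).
Hypotheses (ru : reduced s u) (hb : braid_sequence m u u0 bus).

Let start l := size (braid_word u0 (take l bus)).

Lemma braid_factor l : (l < size bus)%N -> exists p q v,
  m p q = 3%N /\ u = braid_word u0 (take l bus) ++ [:: p; q; p] ++ v.
Proof.
move=> lb; have [uE hb'] := hb.
have [p [q [m3 bE]]] := hb' _ (mem_nth ([::], [::]) lb).
exists p, q, ((nth ([::], [::]) bus l).2 ++
  flatten [seq bu.1 ++ bu.2 | bu <- drop l.+1 bus]).
split=> //; rewrite uE /braid_word -{1}(cat_take_drop l bus).
rewrite (drop_nth ([::], [::]) lb).
by rewrite map_cat flatten_cat /= bE -!catA.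
Qed.

Lemma start_ltn l l' : (l < l')%N -> (l' <= size bus)%N ->
  (start l + 3 <= start l')%N.
Proof.
move=> ll' l'b; have lb : (l < size bus)%N by apply: leq_trans l'b.
have [p [q [_ bE]]] := hb.2 _ (mem_nth ([::], [::]) lb).
rewrite /start /braid_word -(subnKC ll') takeD (take_nth ([::], [::]) lb) -cats1.
rewrite !map_cat !flatten_cat /= bE !size_cat /=; lia.
Qed.

Let triple l : set V :=
  [set position_root u (start l).+2; position_root u (start l);
       position_root u (start l).+2 + position_root u (start l)].

Lemma braid_positions l : (l < size bus)%N ->
  [/\ contractible m s (phi u) (triple l), ((start l).+2 < size u)%N
    & position_root u (start l).+2 + position_root u (start l)
      = position_root u (start l).+1].
Proof.
move=> /braid_factor [p [q [v [m3 uE]]]]; rewrite /triple /start.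
set X := braid_word _ _ in uE *.
have [e2 e1 e0] : [/\ position_root u (size X).+2 = letter_root v p,
    position_root u (size X).+1 = letter_root v p + letter_root v q
    & position_root u (size X) = letter_root v q].
  have := root_seq_braid m3; rewrite /= => -[pqE pqpE]; split.
  - have -> : u = (X ++ [:: p; q]) ++ p :: v by rewrite uE -catA.
    rewrite -[X in X.+2](addn0 (size X)) -!addnS -(size_cat X [:: p; q]).
    exact: position_rootE.
  - have -> : u = (X ++ [:: p]) ++ q :: [:: p] ++ v by rewrite uE -catA.
    rewrite -[X in X.+1](addn0 (size X)) -!addnS -(size_cat X [:: p]).
    by rewrite position_rootE letter_root_cat -letter_rootE /= pqE actD.
  - have -> : u = X ++ p :: [:: q; p] ++ v by rewrite uE.
    by rewrite position_rootE letter_root_cat -letter_rootE /= pqpE.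
rewrite e0 e1 e2; split=> //; last by rewrite uE !size_cat /=; lia.
by rewrite uE; apply: braid_contractible => //; rewrite -uE.
Qed.

(** The leftmost letter of the earlier braid lies outside the later one, and
   letters of a reduced word have distinct roots. *)
Lemma triple_inj l l' : (l < size bus)%N -> (l' < size bus)%N ->
  triple l = triple l' -> l = l'.
Proof.
wlog ll' : l l' / (l < l')%N => [hwlog lb l'b e|].
  have [h|h|//] := ltngtP l l'; first exact: hwlog.
  by apply/esym/hwlog.
move=> lb l'b e; have [_ sz _] := braid_positions lb.
have [_ sz' s2] := braid_positions l'b.
have st := start_ltn ll' (ltnW l'b).
have : triple l' (position_root u (start l)) by rewrite -e; left; right.
by rewrite /triple s2 => -[[|]|] /= /(position_root_inj ru);
  rewrite !inE => h; exfalso; move: h; lia.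
Qed.

Lemma finite_contractible :
  finite_set (contractible_triples m s (phi u) : set (set V)).
Proof.
have [_ mw] := root_seq_inversions ru.
pose f (ab : V * V) : set V := [set ab.1; ab.2; ab.1 + ab.2].
apply: (@sub_finite_set _ _ (f @` ([set` rseq u] `*` [set` rseq u])));
  last first.
  by apply: finite_image; apply: finite_setX; apply: finite_seq.
move=> T [[sT [a [b TE]]] _]; exists (a, b) => //=.
by split=> /=; apply/mw; apply: sT; rewrite TE; [left; left | left; right].
Qed.

(** An injective list of [N(w)] contractible triples exhausts the set of all
   contractible triples, which is finite of this cardinality. *)
Lemma contractible_braid (hN : size bus = num_contractible R m s (phi u)) T :
  contractible m s (phi u) T -> exists2 l, (l < size bus)%N & T = triple l.
Proof.
move=> cT; pose ts := [seq triple l | l <- iota 0 (size bus)].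
pose CT : set (set V) := contractible_triples m s (phi u).
pose S := fset_set CT.
have inS T' : T' \in S = (T' \in CT).
  by rewrite in_fset_set //; apply: finite_contractible.
have uts : uniq ts.
  rewrite map_inj_in_uniq ?iota_uniq // => l l'; rewrite !mem_iota !add0n /=.
  exact: triple_inj.
have sub : {subset ts <= enum_fset S}.
  move=> T' /mapP [l]; rewrite mem_iota add0n /= => lb ->.
  have -> : (triple l \in enum_fset S) = (triple l \in S) by [].
  by rewrite inS inE; have [] := braid_positions lb.
have [|_ tsS] := uniq_min_size uts sub.
  by rewrite size_map size_iota hN.
have : T \in ts by rewrite tsS -[_ \in _]/(T \in S) inS inE.
by move=> /mapP [l]; rewrite mem_iota add0n /= => lb ->; exists l.
Qed.

End Braids.
End RootSequences.

Theorem proposition2p4 (R : realType) (I : finType) (m : I -> I -> nat)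
    (W : finGroupType) (s : I -> W)
    (hm : coxeter_matrix m) (hsl : simply_laced m) (hW : coxeter_system m s)
    (w : W) (hw : freely_braided R m s w)
    (i : seq I) (hi : contracted R m s i) (hiw : reduced_expression s w i)
    (u0 : seq I) (bus : seq (seq I * seq I))
    (hb : braid_sequence m i u0 bus) (hN : size bus = num_contractible R m s w)
    (k : nat) (hk : (k < size i)%N) (hmid : k \notin middle_positions u0 bus) :
  reduced s (delete_letter k i).
Proof.
have [ri iw] := hiw; rewrite -iw in hw hN.
have small : small_pairings R m s := finite_small_pairings hm hsl hW.
have [x0 _] : exists x : I, true by case: (i) hk => // x; exists x.
have iE : i = take k i ++ nth x0 i k :: drop k.+1 i.
  by rewrite -drop_nth // cat_take_drop.
rewrite /delete_letter; apply: contrapT => nr.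
have ri' := ri; rewrite iE in ri'.
have [c [d [ic id cdE]]] := deletion_triple hm hsl hW small ri' nr.
rewrite -iE in ic id.
have rcd : Defs.roots m s (c + d)%R by rewrite cdE; apply: root_letter_root.
have uw : unique_contraction R hW (word_val s i).
  exact: freely_braided_unique.
have con := inversion_triple_contracts hm hsl small uw ic id rcd.
have cT := contracts_contractible hm hsl con.
have [l lb TE] := contractible_braid hm hsl hW ri hb hN cT.
have [[[sub _] _] ltl sumE] := braid_positions R hm hsl hW ri hb lb.
have [rc pc _] := iffLR (inversionE hm hsl hW _ _) ic.
have [rd pd _] := iffLR (inversionE hm hsl hW _ _) id.
set n := size (braid_word u0 (take l bus)) in sub ltl sumE TE.
have ix : inversion_set m s (word_val s i) (position_root R m i n.+2).
  by apply: sub; left; left.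
have iy : inversion_set m s (word_val s i) (position_root R m i n).
  by apply: sub; left; right.
have [rx px _] := iffLR (inversionE hm hsl hW _ _) ix.
have [ry py _] := iffLR (inversionE hm hsl hW _ _) iy.
have := triple_sum_inj hm hsl hW rc rd rx ry pc pd px py TE.
rewrite cdE sumE -(position_rootE R hm hsl hW (take k i)) -iE.
rewrite size_takel ?(ltnW hk) //.
move/(position_root_inj hm hsl hW ri); rewrite !inE => kE.
case/negP: hmid; rewrite kE //; last exact: ltnW.
by apply/mapP; exists l => //; rewrite mem_iota.
Qed.
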